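(* For every $n\ge 1$, the semigroup $\mathrm{Dom}_{T_n}(D_n)$ is regular.
   Context: $X_n=\{1,2,\dots,n\}$ is the finite chain with its usual order, and $T_n$ is the full transformation semigroup of all maps $X_n\to X_n$, written on the right and composed left to right. $D_n=\{\alpha\in T_n: x\alpha\le x \text{ for all } x\in X_n\}$ is the subsemigroup of order-decreasing maps. For a subsemigroup $U$ of a semigroup $S$, an element $d\in S$ is dominated by $U$ if for every semigroup $T$ and all semigroup homomorphisms $f,g:S\to T$ with $f|_U=g|_U$ one has $(d)f=(d)g$; the dominion $\mathrm{Dom}_S(U)$ is the set of all elements of $S$ dominated by $U$ (a subsemigroup of $S$ containing $U$). A semigroup $S$ is regular if for every $a\in S$ there is $b\in S$ with $aba=a$. *)

(* Defs.v *)
From HB Require Import structures.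
From mathcomp Require Import all_boot.

Set Implicit Arguments.
Unset Strict Implicit.
Unset Printing Implicit Defensive.

Local Open Scope group_scope.

(* The chain X_n = {1 < ... < n} is represented by 'I_n = {0 < ... < n - 1}.  *)
(* transf n is a copy of {ffun 'I_n -> 'I_n}, whose product is composition:   *)
(* maps act on the right, so x (a b) = (x a) b is (a * b) x = b (a x).        *)
Definition transf (n : nat) : Type := {ffun 'I_n -> 'I_n}.

HB.instance Definition _ (n : nat) := Finite.on (transf n).

Definition transf_mul (n : nat) (a b : transf n) : transf n :=
  [ffun x => b (a x)].

Lemma transf_mulA (n : nat) : associative (@transf_mul n).
Proof. by move=> a b c; apply/ffunP => x; rewrite !ffunE. Qed.

HB.instance Definition _ (n : nat) :=
  isSemigroup.Build (transf n) (@transf_mulA n).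

Lemma transfM (n : nat) (a b : transf n) (x : 'I_n) : (a * b) x = b (a x).
Proof. by rewrite ffunE. Qed.

Definition order_decreasing (n : nat) : {pred transf n} :=
  [pred a : transf n | [forall x : 'I_n, (a x <= x)%N]].

Lemma order_decreasingM (n : nat) : mulg_closed (@order_decreasing n).
Proof.
move=> a b /forallP ha /forallP hb; apply/forallP => x.
by rewrite transfM; apply: leq_trans (hb _) (ha _).
Qed.

(* The test semigroups T are magmas with an associative product rather than   *)
(* semigroupTypes, because the latter also carry a choice structure: this way *)
(* T ranges over semigroups on arbitrary carriers.                            *)
Definition dominated (S : semigroupType) (U : {pred S}) (d : S) : Prop :=
  forall T : magmaType, associative (@mul T) ->
  forall f g : {multiplicative S -> T},
    (forall u : S, u \in U -> f u = g u) -> f d = g d.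

Definition dominion (S : semigroupType) (U : {pred S}) : S -> Prop :=
  fun d => dominated U d.

Lemma sub_dominion (S : semigroupType) (U : {pred S}) (u : S) :
  u \in U -> dominion U u.
Proof. by move=> uU T _ f g; apply. Qed.

Lemma dominionM (S : semigroupType) (U : {pred S}) (a b : S) :
  dominion U a -> dominion U b -> dominion U (a * b).
Proof.
move=> ha hb T TA f g fg.
by rewrite !gmulfM (ha T TA f g fg) (hb T TA f g fg).
Qed.

(* Regularity of a subsemigroup A as a semigroup in its own right: the        *)
(* element b is required to lie in A, not just in the ambient semigroup.      *)
Definition regular_subsemigroup (S : semigroupType) (A : S -> Prop) : Prop :=
  forall a : S, A a -> exists b : S, A b /\ a * b * a = a.

(* Main.v *)
Require Import Defs.
From HB Require Import structures.
From mathcomp Require Import all_boot.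
From mathcomp Require Import fingroup perm.

Set Implicit Arguments.
Unset Strict Implicit.
Unset Printing Implicit Defensive.

Local Open Scope group_scope.

(* Write 0 for the least point of the chain.  Three facts give regularity.    *)
(* (1) An inverse w of an element v of U such that v w and w v lie in U is    *)
(* dominated by U.  Hence the partial bijections moving one point, extended   *)
(* by sending everything outside their domain to 0, are dominated by D_n, and *)
(* so are the maps moving a single point x <> 0 anywhere.                     *)
(* (2) Composing such moves is like sliding labelled pebbles on the complete  *)
(* graph with 0 kept fixed: if there is a free vertex, then every placement   *)
(* is reachable from every other one.                                         *)
(* (3) Dominated maps fix 0.  Thus a dominated d which is not surjective has  *)
(* a section of its image that extends to a dominated map, whereas a          *)
(* dominated permutation has one of its powers as inverse.                    *)

(** [d * c * d = d] says that [c] restricts to a section of [d] on its image. Such a section may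
    have to raise points; the dominion provides one because it contains all moves of nonzero
    points. *)

(** A zigzag: [v * w] in [U] turns [f w] into [f w * g v * g w], and [w * v] in [U] turns that into
    [g w]. *)
Lemma inverse_dominated (S : semigroupType) (U : {pred S}) (v w : S) :
  v \in U -> v * w \in U -> w * v \in U -> w * v * w = w -> dominated U w.
Proof.
move=> vU vwU wvU wvw T TA f g fg.
have -> : f w = f w * g v * g w.
  by rewrite -TA -gmulfM -(fg _ vwU) -gmulfM mulgA wvw.
by rewrite -(fg _ vU) -gmulfM (fg _ wvU) -gmulfM wvw.
Qed.

Definition collapse (n : nat) (x y : 'I_n) : transf n :=
  [ffun z => if z == x then y else z].

Lemma collapse_dominated (n : nat) (x y : 'I_n.+1) :
  x != ord0 -> dominated (@order_decreasing n.+1) (collapse x y).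
Proof.
move=> x0; have [yx|xy] := leqP y x.
  apply: sub_dominion; apply/forallP => z; rewrite ffunE.
  by case: eqP => [->|].
have nxy : (x == y) = false by apply/negbTE; rewrite neq_ltn xy.
have y0 : y != ord0 by rewrite -val_eqE /= -lt0n (leq_ltn_trans _ xy).
have x0' : (ord0 == x) = false by rewrite eq_sym (negbTE x0).
have y0' : (ord0 == y) = false by rewrite eq_sym (negbTE y0).
(* Mutually inverse bijections between the complements of [x] and [y], with value 0 at the missing
   point. *)
pose v : transf n.+1 :=
  [ffun z => if z == y then x else if z == x then ord0 else z].
pose w : transf n.+1 :=
  [ffun z => if z == x then y else if z == y then ord0 else z].
have vU : v \in @order_decreasing n.+1.
  apply/forallP => z; rewrite ffunE.
  by case: eqP => [->|_]; [exact: ltnW|case: eqP].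
have vwU : v * w \in @order_decreasing n.+1.
  apply/forallP => z; rewrite transfM !ffunE.
  have [->|zy] := eqVneq z y; first by rewrite eqxx.
  have [->|zx] := eqVneq z x; last by rewrite (negbTE zx) (negbTE zy).
  by rewrite !(x0', y0').
have wvU : w * v \in @order_decreasing n.+1.
  apply/forallP => z; rewrite transfM !ffunE.
  have [->|zx] := eqVneq z x; first by rewrite eqxx.
  have [->|zy] := eqVneq z y; last by rewrite (negbTE zx) (negbTE zy).
  by rewrite !(x0', y0').
have wvw : w * v * w = w.
  apply/ffunP => z; rewrite !transfM !ffunE.
  have [_|zx] := eqVneq z x; first by rewrite !eqxx.
  have [_|zy] := eqVneq z y; last by rewrite !(negbTE zx, negbTE zy).
  by rewrite !(x0', y0').
(* [w] alone would send [y] to 0, so [y] is first merged into [x]. *)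
have -> : collapse x y = collapse y x * w.
  apply/ffunP => z; rewrite transfM !ffunE.
  have [->|zx] := eqVneq z x; first by rewrite nxy eqxx.
  by have [->|zy] := eqVneq z y; rewrite ?eqxx // (negbTE zx) (negbTE zy).
apply: dominionM; last exact: inverse_dominated wvw.
apply: sub_dominion; apply/forallP => z; rewrite ffunE.
by case: eqP => [->|_]; rewrite // ltnW.
Qed.

(** Pebbles occupy [B], the one at [z] has target [b z], and [h] is a free vertex. Induction is on
    the number of pebbles off target. *)
Lemma dominated_section (n : nat) (B : {set 'I_n.+1}) (b : 'I_n.+1 -> 'I_n.+1) :
  ord0 \in B -> (exists h, h \notin B) -> {in B &, injective b} ->
  b ord0 = ord0 ->
  exists2 c, dominated (@order_decreasing n.+1) c & {in B, forall x, c x = b x}.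
Proof.
have [m] := ubnP #|[set x in B | b x != x]|.
elim: m => // m IHm in B b *; rewrite ltnS => le_m.
(* A pebble whose target is free moves there, which fixes one more point. *)
have free_target (B' : {set 'I_n.+1}) (b' : 'I_n.+1 -> 'I_n.+1) x :
    #|[set z in B' | b' z != z]| <= m -> ord0 \in B' ->
    {in B' &, injective b'} -> b' ord0 = ord0 -> x \in B' -> b' x \notin B' ->
    exists2 c, dominated (@order_decreasing n.+1) c
             & {in B', forall z, c z = b' z}.
  move=> le_m' B'0 b'I b'0 xB' b'xB'.
  have x0 : x != ord0 by apply: contraNneq b'xB' => ->; rewrite b'0.
  have b'xx : b' x != x by apply: contraNneq b'xB' => ->.
  pose y := b' x; pose b2 z := if z == y then y else b' z.
  have [|||||c cD cE] := IHm (y |: B' :\ x) b2.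
  - apply: leq_trans le_m'; apply: proper_card; apply/properP; split.
      apply/subsetP => z; rewrite !inE /b2.
      by case: (z =P y) => [->|_]; rewrite ?eqxx ?andbF //= -andbA => /and3P[_ -> ->].
    by exists x; rewrite !inE ?xB' // /b2 eqxx /= orbF /b2 eq_sym (negbTE b'xx).
  - by rewrite !inE B'0 (eq_sym _ x) x0 orbT.
  - by exists x; rewrite !inE eqxx orbF eq_sym.
  - have b'y z : z \in B' :\ x -> b' z <> y.
      by rewrite !inE => /andP[zx zB'] /b'I zxE; rewrite zxE ?eqxx in zx.
    move=> z t; rewrite /b2 !in_setU1.
    case: (z =P y) => [->|_] /=; case: (t =P y) => [->|_] //= zB tB e.
    + by case: (b'y t).
    + by case: (b'y z).
    + by move: zB tB; rewrite !inE => /andP[_ zB] /andP[_ tB]; apply: b'I.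
  - by rewrite /b2 b'0; case: eqP.
  exists (collapse x y * c); first exact/dominionM/cD/collapse_dominated.
  move=> z zB'; rewrite transfM ffunE; case: (z =P x) => [->|/eqP zx].
    by rewrite cE /b2 ?eqxx // setU11.
  rewrite cE /b2; last by rewrite !inE zx zB' orbT.
  by case: eqP => // zy; rewrite -/y -zy zB' in b'xB'.
move=> B0 [h hB] bI b0.
have [/existsP[x /andP[xB bxB]]|] := boolP [exists x, (x \in B) && (b x \notin B)].
  exact: (free_target B b x).
rewrite negb_exists => /forallP bB.
have [fixB|[x /[!inE]/andP[xB bxx]]] := set_0Vmem [set x in B | b x != x].
  exists [ffun z => z].
    by apply: sub_dominion; apply/forallP => z; rewrite ffunE.
  move=> z zB; rewrite ffunE; apply/esym/eqP.
  by move/setP: fixB => /(_ z); rewrite !inE zB => /negbFE.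
(* Every pebble has an occupied target: vacate x by moving its pebble to h. *)
have imB : b @: B = B.
  apply/eqP; rewrite eqEcard card_in_imset // leqnn andbT.
  apply/subsetP => _ /imsetP[z zB ->].
  by have := bB z; rewrite zB negbK.
have : x \in b @: B by rewrite imB.
case/imsetP => y yB xby.
have yx : y != x by apply: contraNneq bxx => yx; rewrite -{1}yx -xby.
have x0 : x != ord0 by apply: contraNneq bxx => ->; rewrite b0.
have xh : x != h by apply: contraNneq hB => <-.
pose b2 z := if z == h then b x else b z.
have b2h z : z \in B -> b2 z = b z.
  by rewrite /b2; case: eqP => // -> hB'; rewrite hB' in hB.
have [|||||| c cD cE] := free_target (h |: B :\ x) b2 y.
(* Dropping [x] pays for the possibly misplaced pebble at [h], so the count does not grow. *)
- rewrite (leq_trans _ le_m) // [leqRHS](cardsD1 x) inE xB bxx.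
  apply: leq_trans (_ : #|h |: ([set z in B | b z != z] :\ x)| <= _).
    apply/subset_leq_card/subsetP => z; rewrite !inE.
    case: (z =P h) => //= _ /andP[/andP[zx zB]].
    by rewrite b2h // zx zB.
  by rewrite cardsU1 leq_add2r leq_b1.
- by rewrite !inE B0 (eq_sym _ x) x0 orbT.
- move=> z t; rewrite !inE /b2.
  case: (z =P h) => [->|_] /=; case: (t =P h) => [->|_] //=.
  + by move=> _ /andP[tx tB] /bI e; rewrite -e ?eqxx in tx.
  + by move=> /andP[zx zB] _ /bI e; rewrite e ?eqxx in zx.
  + by move=> /andP[_ zB] /andP[_ tB]; apply: bI.
- by rewrite b2h.
- by rewrite !inE yx yB orbT.
- by rewrite b2h // -xby !inE eqxx orbF.
exists (collapse x h * c); first exact/dominionM/cD/collapse_dominated.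
move=> z zB; rewrite transfM ffunE; case: (z =P x) => [->|/eqP zx].
  by rewrite cE /b2 ?eqxx // setU11.
by rewrite cE ?b2h // !inE zx zB orbT.
Qed.

Section ShiftExtension.
Variable n : nat.

(* An element (s, v) carries a function v on subsets, on which t acts by      *)
(* A |-> v (t^-1 A).  With e_x the indicator of the sets containing x, the    *)
(* twist s |-> (s, e_x + e_(s x)) is multiplicative and agrees with           *)
(* s |-> (s, 0) exactly at the maps fixing x.                                 *)
Definition shift_ext : Type := transf n * {ffun {set 'I_n} -> bool}.

Definition shift_mul (p q : shift_ext) : shift_ext :=
  (p.1 * q.1, [ffun A : {set 'I_n} => p.2 (q.1 @^-1: A) (+) q.2 A]).

HB.instance Definition _ := hasMul.Build shift_ext shift_mul.

Lemma shift_mulA : associative shift_mul.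
Proof.
move=> p q r; rewrite /shift_mul mulgA; congr pair; apply/ffunP => A.
rewrite !ffunE addbA; congr (p.2 _ (+) _ (+) _).
by apply/setP => z; rewrite !inE transfM.
Qed.

Definition shift_triv (s : transf n) : shift_ext := (s, [ffun=> false]).

Lemma shift_trivM : {morph shift_triv : s t / s * t}.
Proof.
move=> s t; rewrite /mul /= /shift_mul; congr pair.
by apply/ffunP => A; rewrite !ffunE.
Qed.

HB.instance Definition _ :=
  isMultiplicative.Build (transf n) shift_ext shift_triv shift_trivM.

Definition shift_twist (x : 'I_n) (s : transf n) : shift_ext :=
  (s, [ffun A : {set 'I_n} => (x \in A) (+) (s x \in A)]).

Lemma shift_twistM (x : 'I_n) : {morph shift_twist x : s t / s * t}.
Proof.
move=> s t; rewrite {2}/mul /= /shift_mul; congr pair.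
apply/ffunP => A; rewrite !ffunE !inE.
by case: (x \in A); case: (t x \in A); case: (t (s x) \in A).
Qed.

HB.instance Definition _ (x : 'I_n) :=
  isMultiplicative.Build (transf n) shift_ext (shift_twist x)
    (shift_twistM x).

Lemma dominated_fixes (U : {pred transf n}) (x : 'I_n) (d : transf n) :
  (forall u, u \in U -> u x = x) -> dominated U d -> d x = x.
Proof.
move=> Ux dD; have fgU u : u \in U -> shift_triv u = shift_twist x u.
  by move=> /Ux ux; congr pair; apply/ffunP => A; rewrite !ffunE ux addbb.
(* At the singleton of [d x] the twist vanishes only if [d x = x]. *)
have [/ffunP/(_ [set d x])] := dD _ shift_mulA shift_triv (shift_twist x) fgU.
by rewrite !ffunE !inE eqxx addbT => /esym/negbFE/eqP.
Qed.

End ShiftExtension.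

Lemma dominated_perm_regular (n : nat) (U : {pred transf n}) (d : transf n) :
  injective d -> dominated U d -> exists b, dominated U b /\ d * b * d = d.
Proof.
(* The witness is [d] to the power [k.+1], and [k.+2] is twice the order of [p]; doubling keeps the
   exponent positive even when [p] is trivial. *)
move=> dI dD; pose p := perm dI; pose k := (#[p].-1).*2.
have pE x : p x = d x by rewrite permE.
have powD j : dominated U (iter j (fun e => d * e) d).
  by elim: j => //= j IHj; apply: dominionM.
have powE j x : iter j (fun e => d * e) d x = (p ^+ j.+1) x.
  elim: j x => [|j IHj] x /=; first by rewrite pE.
  by rewrite transfM IHj [in RHS]expgS permM pE.
have pk : p ^+ k.+2 = 1.
  by rewrite /k -doubleS prednK ?order_gt0 // -muln2 expgM expg_order expg1n.
exists (iter k (fun e => d * e) d); split=> //; apply/ffunP => x.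
by rewrite !transfM powE -!pE -permM -expgSr pk perm1.
Qed.

Theorem mainTheorem3 (n : nat) (n_ge1 : (1 <= n)%N) :
  regular_subsemigroup (dominion (@order_decreasing n)).
Proof.
case: n n_ge1 => // n _ d dD.
have d0 : d ord0 = ord0.
  apply: dominated_fixes dD => u /forallP/(_ ord0).
  by rewrite leqn0 => /eqP u0; apply: val_inj.
have [/forallP dS|] := boolP [forall y, y \in codom d].
  apply: dominated_perm_regular dD; apply/injectiveP.
  apply: (leq_size_uniq (enum_uniq _)) => [y _|]; first exact: dS.
  by rewrite size_codom cardE.
rewrite negb_forall => /existsP[h hd].
(* The value at 0 is forced, since [pick] might choose another preimage of 0 while dominated maps
   fix 0. *)
pose b y := if y == ord0 then ord0 else odflt ord0 [pick x | d x == y].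
have dbE y : y \in codom d -> d (b y) = y.
  case/codomP => x ->; rewrite /b; case: eqP => [->//|_].
  by case: pickP => [z /eqP//|/(_ x)]; rewrite eqxx.
have [||||c cD cE] := @dominated_section n [set y in codom d] b.
- by rewrite inE -d0 codom_f.
- by exists h; rewrite inE.
- by move=> y z; rewrite !inE => /dbE{2}<- /dbE{2}<- ->.
- by rewrite /b eqxx.
exists c; split=> //; apply/ffunP => x.
by rewrite !transfM cE ?dbE ?inE ?codom_f.
Qed.
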